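(* Let $\mathcal F$ be a saturated formation such that $\mathcal N\subseteq\mathcal F\subseteq\mathcal U$, let $n\ge1$, and let $G$ be a finite soluble group. If every $n$-maximal subgroup of $G$ is $\mathcal F$-subnormal in $G$ and $|\pi(G)|\ge n$, then $G$ is $\phi$-dispersive for some ordering $\phi$ of the set $\mathbb P$ of all primes.
   Context: All groups are finite. $\pi(G)$ is the set of prime divisors of $|G|$; $\mathcal N$ and $\mathcal U$ are the classes of all nilpotent and all supersoluble groups; $\Phi(G)$ is the Frattini subgroup of $G$. For a class $\mathcal F$ of groups with $1\in\mathcal F$, $G^{\mathcal F}$ is the intersection of all normal subgroups $N$ of $G$ with $G/N\in\mathcal F$. A class $\mathcal F$ is a formation if either $\mathcal F=\emptyset$, or $1\in\mathcal F$ and every homomorphic image of $G/G^{\mathcal F}$ belongs to $\mathcal F$ for any group $G$. A formation $\mathcal F$ is saturated if $G/\Phi(G)\in\mathcal F$ implies $G\in\mathcal F$ for any group $G$. Let $\phi$ be a (linear) ordering of $\mathbb P$; $p\,\phi\,q$ means that $p$ precedes $q$ in $\phi$ and $p\ne q$. A group $G$ of order $p_1^{\alpha_1}\cdots p_m^{\alpha_m}$ is $\phi$-dispersive if $p_1\,\phi\,p_2\,\phi\cdots\phi\,p_m$ and for every $i$ there is a normal subgroup of $G$ of order $p_1^{\alpha_1}\cdots p_i^{\alpha_i}$. A $1$-maximal subgroup of $G$ is a maximal subgroup of $G$; for $n\ge2$, an $n$-maximal subgroup of $G$ is a maximal subgroup of some $(n-1)$-maximal subgroup of $G$. For a non-empty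 formation $\mathcal F$, a subgroup $H$ of $G$ is $\mathcal F$-subnormal in $G$ if either $H=G$ or there is a chain $H=H_0<H_1<\dots<H_k=G$ such that, for $i=1,\dots,k$, $H_{i-1}$ is a maximal subgroup of $H_i$ and $H_i/(H_{i-1})_{H_i}\in\mathcal F$, where $(H_{i-1})_{H_i}$ is the core of $H_{i-1}$ in $H_i$ (the largest normal subgroup of $H_i$ contained in $H_{i-1}$). *)

(* Defs.v *)
From mathcomp Require Import all_boot all_order all_fingroup all_solvable.
From mathcomp Require Import boolp.

Set Implicit Arguments.
Unset Strict Implicit.
Unset Printing Implicit Defensive.

Local Open Scope group_scope.

Record group_class := GroupClass {
  in_class :> forall gT : finGroupType, {group gT} -> Prop;
  in_class_isog : forall (gT rT : finGroupType) (G : {group gT})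
    (H : {group rT}), G \isog H -> in_class G -> in_class H
}.

Arguments in_class F {gT} G%_G : rename.

Definition empty_class (F : group_class) : Prop :=
  forall (gT : finGroupType) (G : {group gT}), ~ F gT G.

Definition has_trivial (F : group_class) : Prop :=
  forall gT : finGroupType, F gT 1%G.

(* A normal series of G (every term normal in G) with cyclic factors. *)
Definition supersolvable (gT : finGroupType) (G : {group gT}) : Prop :=
  exists2 s : seq {group gT},
    path [rel H K : {group gT} | [&& H \subset K, K <| G & cyclic (K / H)]]
         1%G s
    & last 1%G s = G.

(* Meaningful when [has_trivial F]; then G itself is one of the N. *)
Definition residual (F : group_class) (gT : finGroupType) (G : {group gT}) :
    {group gT} :=
  [group of \bigcap_(N : {group gT} | (N <| G) && `[< F _ (G / N)%G >]) N].

Definition formation (F : group_class) : Prop :=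
  empty_class F \/
  has_trivial F /\
  forall (gT : finGroupType) (G : {group gT}) (rT : finGroupType)
    (f : {morphism G / residual F G >-> rT}),
    F rT (f @* (G / residual F G))%G.

Definition saturated (F : group_class) : Prop :=
  forall (gT : finGroupType) (G : {group gT}), F _ (G / 'Phi(G))%G -> F gT G.

(* [n_maximal G n H]: H is an n-maximal subgroup of G; empty for n = 0. *)
Inductive n_maximal (gT : finGroupType) (G : {group gT}) :
    nat -> {group gT} -> Prop :=
| OneMaximal (H : {group gT}) : maximal H G -> n_maximal G 1 H
| SuccMaximal (n : nat) (K H : {group gT}) :
    n_maximal G n K -> maximal H K -> n_maximal G n.+1 H.

(* [gcore H K] is the core of H in K when H is a subgroup of K. *)
Inductive F_subnormal (F : group_class) (gT : finGroupType) (G : {group gT}) :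
    {group gT} -> Prop :=
| FSubnormalRefl : F_subnormal F G G
| FSubnormalStep (H K : {group gT}) :
    maximal H K -> F _ (K / gcore H K)%G -> F_subnormal F G K ->
    F_subnormal F G H.

(* Non-strict linear orders, constrained on the primes only; reflexivity there
   is an instance of totality. *)
Definition prime_ordering (phi : rel nat) : Prop :=
  [/\ {in prime &, total phi},
      {in prime &, antisymmetric phi}
    & {in prime & &, transitive phi}].

Definition dispersive (phi : rel nat) (gT : finGroupType) (G : {group gT}) :
    Prop :=
  exists ps : seq nat,
    [/\ perm_eq ps (primes #|G|),
        sorted [rel p q | phi p q && (p != q)] ps
      & forall i : nat, 0 < i <= size ps ->
          exists2 N : {group gT},
            N <| G & #|N| = (\prod_(p <- take i ps) p ^ logn p #|G|)%N].

(* Main.v *)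
(** All chains defining F-subnormality have supersolvable sections K / core(H),
and a supersolvable group has, for every k, a normal Hall subgroup for the primes
>= k. Let r be the largest prime divisor of |G| and R a Sylow r-subgroup. If an
F-subnormal subgroup K contains R, then it contains every r-subgroup of G, so
that R is normal in G as soon as it is normal in some M between K and G. If
|pi(G)| > n, there is an n-maximal K containing R, because indices of maximal
subgroups of a solvable group are prime powers, and induction on n shows that R
is normal in G.
  If |pi(G)| >= n, some Sylow subgroup of G is normal: otherwise take a minimal
normal q-subgroup N. By induction G / N has a normal Sylow subgroup S / N, and the
Frattini argument on S shows that N is complemented by a maximal subgroup M.
Now pi(M) = pi(G), so the previous case, applied to M and n - 1, makes the Sylow
r-subgroup R of M normal in M; then N R (if q = r) or R (if q <> r) is a normal
Sylow subgroup of G. Finally let P be a normal Sylow subgroup. The hypothesis passes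
to G / P if n = 1, and G / P is an image of a maximal subgroup of G, to which the
hypothesis passes with n - 1, if n > 1; in both cases G / P is dispersive by
induction, and G is dispersive for the order modified by putting p first. *)

Require Import Defs.
From mathcomp Require Import all_boot all_order all_fingroup all_solvable.

Set Implicit Arguments.
Unset Strict Implicit.
Unset Printing Implicit Defensive.

Local Open Scope group_scope.

(** * Normal Hall subgroups of supersolvable groups *)

Definition from_nat_pred (k : nat) : nat_pred := [pred p | k <= p].

Lemma dvdn_index_normal (gT : finGroupType) (K A L : {group gT}) :
  A <| K -> L \subset K -> #|L : A| %| #|K : A|.
Proof.
move=> /andP[_ nAK] sLK.
rewrite -(card_quotient (subset_trans sLK nAK)) -(card_quotient nAK).
by rewrite cardSg // quotientS.
Qed.

Lemma index_quotient_normal (gT : finGroupType) (D B K : {group gT}) :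
  D <| K -> D \subset B -> B \subset K -> #|K / D : B / D| = #|K : B|.
Proof.
case/andP=> _ nDK sDB sBK.
by rewrite index_quotient_eq // subIset // sDB orbT.
Qed.

(** A prime divisor of [totient (q ^ e)] is [q] or divides [q - 1], hence is at most [q]. *)
Lemma pnat_totient (k n : nat) :
  (from_nat_pred k)^'.-nat n -> (from_nat_pred k)^'.-nat (totient n).
Proof.
case/andP=> n_gt0 /allP pi_n; apply/pnatP=> [|p p_pr]; first by rewrite totient_gt0.
rewrite totientE // Euclid_dvd_prod // big_has => /hasP[q q_n].
have:= pi_n q q_n; move: q_n; rewrite mem_primes !inE -!ltnNge => /and3P[q_pr _ _].
move=> lt_qk dv; apply: leq_ltn_trans lt_qk.
move: dv; rewrite Euclid_dvdM // Euclid_dvdX //.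
case/orP=> [|/andP[]] dv; last by move=> _; rewrite dvdn_leq ?prime_gt0.
apply: leq_trans (leq_pred q); apply: dvdn_leq dv.
by have:= prime_gt1 q_pr; case: (q) => [|[]].
Qed.

(** The [pi^']-part [B] of [C] is a normal Hall subgroup of [X], and its Schur-Zassenhaus complement
    is normal because [X] centralises [B]. *)
Lemma pcore_Hall_cyclic_ext (gT : finGroupType) (k : nat) (X C : {group gT}) :
    C <| X -> cyclic C -> (from_nat_pred k).-nat #|X : C| ->
  (from_nat_pred k).-Hall(X) 'O_(from_nat_pred k)(X).
Proof.
set pi := from_nat_pred k => nsCX cycC piXC.
have [sCX nCX] := andP nsCX; set B := 'O_pi^'(C).
have hallBC: pi^'.-Hall(C) B.
  exact/nilpotent_pcore_Hall/abelian_nil/cyclic_abelian.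
have sBC: B \subset C := pcore_sub _ _.
have nsBX: B <| X := char_normal_trans (pcore_char _ _) nsCX.
have hallB: pi^'.-Hall(X) B.
  rewrite /pHall (normal_sub nsBX) pcore_pgroup pnatNK.
  rewrite -(Lagrange_index sCX sBC) pnatM piXC -[pi.-nat _]pnatNK.
  by case/and3P: hallBC.
have cBC: C \subset 'C_X(B).
  by rewrite subsetI sCX; apply: sub_abelian_cent (cyclic_abelian cycC) sBC.
(* X / C_X(B) is both a pi-group and, embedding in the automorphism group of a
   cyclic group with all primes < k, a pi'-group. *)
have cBX: X \subset 'C(B).
  have sCX1: 'C_X(B) \subset X := subsetIl _ _.
  suffices: #|X : 'C_X(B)| == 1%N.
    by rewrite -[_ == _]/(_ == 1%N) indexg_eq1 subsetI subxx.
  apply/eqP/(@pnat_1 pi).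
    by apply: pnat_dvd piXC; rewrite -(Lagrange_index sCX1 cBC) dvdn_mulr.
  rewrite indexgI; apply: (@pnat_dvd _ #|Aut B|); last first.
    rewrite card_Aut_cyclic ?(cyclicS sBC) //.
    exact/pnat_totient/pcore_pgroup.
  have:= cardSg (Aut_conj_aut [group of B] X); rewrite card_morphim ker_conj_aut.
  by rewrite (setIidPr (normal_norm nsBX)).
have [E complE] := splitsP (SchurZassenhaus_split (pHall_Hall hallB) nsBX).
have hallE: pi.-Hall(X) E by rewrite -pHallNK -(compl_pHall _ hallB).
have [_ defX] := complP complE.
have nsEX: E <| X.
  rewrite /normal (pHall_sub hallE) -{1}defX mul_subG ?normG //.
  by rewrite cents_norm // centsC (subset_trans _ cBX) ?(pHall_sub hallE).
by rewrite (normal_Hall_pcore hallE nsEX).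
Qed.

(** With [A] obtained from [K] by induction, [A / H] extends the cyclic [K / H] by a group with all
    primes at least [k], so it has a normal Hall subgroup for these primes, which is characteristic
    and hence normal in [G / H]. *)
Lemma supersolvable_series (gT : finGroupType) (k : nat) (G : {group gT}) s
    (H : {group gT}) :
    H <| G -> last H s = G ->
    path [rel H K : {group gT} | [&& H \subset K, K <| G & cyclic (K / H)]] H s ->
  exists A : {group gT}, [/\ H \subset A, A <| G,
    (from_nat_pred k).-nat #|A : H| & (from_nat_pred k)^'.-nat #|G : A|].
Proof.
set pi := from_nat_pred k.
elim: s H => [|K s IHs] H nsHG /= => [->|lastG /andP[/and3P[sHK nsKG cycKH] pathK]].
  by exists G; rewrite indexgg.
have [A [sKA nsAG piAK pi'GA]] := IHs K nsKG lastG pathK.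
have sHA := subset_trans sHK sKA; have [sAG nAG] := andP nsAG.
have [sHG nHG] := andP nsHG; have nHA := subset_trans sAG nHG.
have nsHA: H <| A by apply/andP.
have nsKA: K <| A by rewrite (normalS sKA sAG).
have hallE: pi.-Hall(A / H) 'O_pi(A / H).
  apply: (@pcore_Hall_cyclic_ext _ _ _ (K / H)); rewrite ?quotient_normal //.
  by rewrite index_quotient_normal.
have nsE: 'O_pi(A / H) <| G / H.
  by apply: char_normal_trans (pcore_char _ _) (quotient_normal _ nsAG).
have [E defE sHE nsEG] := inv_quotientN nsHG nsE.
have nsHE: H <| E by rewrite (normalS sHE (normal_sub nsEG)).
have sEA: E \subset A.
  by rewrite -(quotientSGK _ sHA) -?defE ?pcore_sub ?(subset_trans (normal_sub nsEG)).
exists E; split=> //.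
  by rewrite -card_quotient ?normal_norm // -defE; apply: pcore_pgroup.
rewrite -(Lagrange_index sAG sEA) pnatM pi'GA /=.
rewrite -(index_quotient_normal nsHA) // -defE.
by case/and3P: hallE.
Qed.

(** * Subnormal chains and the largest prime *)

(* H contains a normal subgroup D of K such that K / D has a normal Hall subgroup
   A / D for the primes >= k. Indices replace quotients so that the relation is
   inherited by subgroups and quotients without iterated coset types. *)
Definition ore_step (gT : finGroupType) (H K : {group gT}) : Prop :=
  H \subset K /\ forall k, exists D A : {group gT},
    [/\ D \subset H, D <| K, [/\ D \subset A & A <| K],
        (from_nat_pred k).-nat #|A : D| & (from_nat_pred k)^'.-nat #|K : A|].

(** Links need not be maximal: intersecting with a subgroup or taking quotients may destroy
    maximality. *)
Inductive ore_subnormal (gT : finGroupType) (G : {group gT}) :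
    {group gT} -> Prop :=
| OreRefl : ore_subnormal G G
| OreStep (H K : {group gT}) :
    ore_step H K -> ore_subnormal G K -> ore_subnormal G H.

Lemma ore_subnormal_sub (gT : finGroupType) (G H : {group gT}) :
  ore_subnormal G H -> H \subset G.
Proof. by elim=> // {}H K [sHK _] _; apply: subset_trans. Qed.

Lemma F_subnormal_ore (F : group_class) (gT : finGroupType) (G H : {group gT}) :
    (forall (rT : finGroupType) (K : {group rT}), F rT K -> supersolvable K) ->
  F_subnormal F G H -> ore_subnormal G H.
Proof.
move=> sF; elim=> [|{}H K maxH FK _ oreK]; first exact: OreRefl.
apply: OreStep oreK; have sHK := maxgroupp maxH; split=> [|k].
  exact: proper_sub sHK.
have nsDK : gcore H K <| K by rewrite gcore_normal // proper_sub.
have [s path_s last_s] := sF _ _ FK.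
have [A [_ nsA piA pi'A]] := supersolvable_series k (normal1 _) last_s path_s.
have [B defB sDB nsBK] := inv_quotientN nsDK nsA.
exists [group of gcore H K], B; split=> //; first exact: gcore_sub.
  have nDB := subset_trans (normal_sub nsBK) (normal_norm nsDK).
  by move: piA; rewrite indexg1 defB card_quotient.
by move: pi'A; rewrite defB (index_quotient_normal nsDK) //; apply: normal_sub.
Qed.

Lemma ore_stepI (gT : finGroupType) (L H K : {group gT}) :
  ore_step H K -> ore_step (L :&: H) (L :&: K).
Proof.
case=> sHK oreHK; split=> [|k]; first exact: setIS.
have [D [A [sDH nsDK [sDA nsAK] piAD pi'KA]]] := oreHK k.
have nsLI (B C : {group gT}) : B <| C -> L :&: B <| L :&: C.
  move=> nsBC; rewrite -[L :&: B](_ : L :&: C :&: B = _).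
    exact: normalGI (subsetIr _ _) nsBC.
  by rewrite -setIA (setIidPr (normal_sub nsBC)).
have idxLI (B C : {group gT}) : B <| C -> #|L :&: C : L :&: B| %| #|C : B|.
  move=> nsBC; rewrite -[L :&: B](_ : L :&: C :&: B = _).
    by rewrite indexgI dvdn_index_normal ?subsetIr.
  by rewrite -setIA (setIidPr (normal_sub nsBC)).
have nsDA := normalS sDA (normal_sub nsAK) nsDK.
exists (L :&: D)%G, (L :&: A)%G; split; rewrite ?setIS ?nsLI //=.
  exact: pnat_dvd (idxLI _ _ nsDA) piAD.
exact: pnat_dvd (idxLI _ _ nsAK) pi'KA.
Qed.

Lemma ore_subnormalI (gT : finGroupType) (L G H : {group gT}) :
  L \subset G -> ore_subnormal G H -> ore_subnormal L (L :&: H).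
Proof.
move=> sLG; elim=> [|{}H K /(ore_stepI L) oreHK _]; last exact: OreStep.
by rewrite (_ : L :&: G = L)%G; [apply: OreRefl | apply/group_inj/setIidPl].
Qed.

Lemma ore_subnormal_in (gT : finGroupType) (L G H : {group gT}) :
  H \subset L -> L \subset G -> ore_subnormal G H -> ore_subnormal L H.
Proof.
move=> sHL sLG /(ore_subnormalI sLG).
by rewrite (_ : L :&: H = H)%G //; apply/group_inj/setIidPr.
Qed.

Lemma ore_step_quotient (gT : finGroupType) (N H K : {group gT}) :
  K \subset 'N(N) -> ore_step H K -> ore_step (H / N) (K / N).
Proof.
move=> nNK [sHK oreHK]; split=> [|k]; first exact: quotientS.
have [D [A [sDH nsDK [sDA nsAK] piAD pi'KA]]] := oreHK k.
have nNA := subset_trans (normal_sub nsAK) nNK.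
exists (D / N)%G, (A / N)%G; split; rewrite ?quotientS ?quotient_normal //=.
  by apply: pnat_dvd piAD; rewrite index_quotient // subIset ?nNA.
by apply: pnat_dvd pi'KA; rewrite index_quotient // subIset ?nNK.
Qed.

Lemma ore_subnormal_quotient (gT : finGroupType) (N G H : {group gT}) :
  N <| G -> ore_subnormal G H -> ore_subnormal (G / N) (H / N).
Proof.
case/andP=> _ nNG; elim=> [|{}H K oreHK oreK]; first exact: OreRefl.
apply/OreStep/ore_step_quotient/oreHK.
exact: subset_trans (ore_subnormal_sub oreK) nNG.
Qed.

(** At [k = r] the index of [A] in [K] is prime to [r], so [A] contains all [r]-subgroups of [K]; as
    [r] bounds the primes, [A / D] is an [r]-group. Hence [A = D <*> R], which lies in [H]. *)
Lemma ore_step_Sylow (gT : finGroupType) (r : nat) (H K R Q : {group gT}) :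
    ore_step H K -> r.-Sylow(K) R -> R \subset H ->
    {in \pi(K), forall p, p <= r} -> Q \subset K -> r.-group Q ->
  Q \subset H.
Proof.
case=> sHK /(_ r)[D [A [sDH nsDK [sDA nsAK] piAD pi'KA]]] sylR sRH r_max sQK rQ.
have sAK := normal_sub nsAK; have nDA := subset_trans sAK (normal_norm nsDK).
have sub_A (P : {group gT}) : P \subset K -> r.-group P -> P \subset A.
  move=> sPK rP; rewrite -indexg_eq1; apply/eqP/(@pnat_1 r).
    exact: pnat_dvd (dvdn_indexg _ _) rP.
  have: (from_nat_pred r)^'.-nat #|P : A|.
    exact: pnat_dvd (dvdn_index_normal nsAK sPK) pi'KA.
  by apply: sub_in_pnat => p _; apply: contraNN => /eqP->; rewrite !inE /=.
have [sRK rR r'KR] := and3P sylR; have sRA := sub_A R sRK rR.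
have nDR := subset_trans sRA nDA.
suffices defA: D <*> R = A.
  by apply: subset_trans (sub_A Q sQK rQ) _; rewrite -defA join_subG sDH.
have sDRA: D <*> R \subset A by rewrite join_subG sDA.
apply/eqP; rewrite eqEsubset sDRA -indexg_eq1; apply/eqP/(@pnat_1 r).
  apply: (@pnat_dvd _ #|A : D|).
    by rewrite -(Lagrange_index sDRA (joing_subl _ _)) dvdn_mulr.
  apply: sub_in_pnat piAD => p p_dv; rewrite !inE => le_rp.
  rewrite eqn_leq le_rp r_max //; apply: pi_of_dvd p_dv; rewrite ?cardG_gt0 //.
  exact: dvdn_trans (dvdn_indexg _ _) (cardSg sAK).
apply: pnat_dvd r'KR; rewrite -(Lagrange_index sAK sRA) dvdn_mull //.
by rewrite -(Lagrange_index sDRA (joing_subr _ _)) dvdn_mulr.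
Qed.

Lemma ore_subnormal_Sylow (gT : finGroupType) (r : nat) (H G R Q : {group gT}) :
    ore_subnormal G H -> r.-Sylow(G) R -> R \subset H ->
    {in \pi(G), forall p, p <= r} -> Q \subset G -> r.-group Q ->
  Q \subset H.
Proof.
move=> oreH sylR sRH r_max sQG rQ; elim: oreH sRH => // {}H K oreHK oreK sQK sRH.
have sKG := ore_subnormal_sub oreK; have sRK := subset_trans sRH oreHK.1.
apply: ore_step_Sylow oreHK _ sRH _ (sQK sRK) rQ.
  exact: pHall_subl sRK sKG sylR.
by move=> p /(pi_of_dvd (cardSg sKG) (cardG_gt0 _)); apply: r_max.
Qed.

Lemma Sylow_normal_ore (gT : finGroupType) (r : nat) (M G K R : {group gT}) :
    ore_subnormal G K -> K \subset M -> r.-Sylow(G) R -> R \subset K ->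
    {in \pi(G), forall p, p <= r} -> R <| M -> M \subset G -> R <| G.
Proof.
move=> oreK sKM sylR sRK r_max nsRM sMG; have [sRG rR _] := and3P sylR.
apply/andP; split=> //; apply/subsetP=> x Gx; rewrite inE.
have sylRM := pHall_subl (normal_sub nsRM) sMG sylR.
rewrite (sub_normal_Hall sylRM) ?pgroupJ //.
apply: subset_trans sKM; apply: ore_subnormal_Sylow oreK sylR sRK r_max _ _.
  by rewrite conj_subG.
by rewrite pgroupJ.
Qed.

(** * Maximal and n-maximal subgroups of solvable groups *)

Lemma maximal_mulg (gT : finGroupType) (G M U : {group gT}) :
  maximal M G -> U <| G -> ~~ (U \subset M) -> (U * M)%g = G.
Proof.
case/maxgroupP=> /properP[sMG _] maxM nsUG; have [sUG nUG] := andP nsUG.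
rewrite -norm_joinEr ?(subset_trans sMG) //; apply: contraNeq => neUMG.
have <-: U <*> M = M; last exact: joing_subl.
apply: (maxM (U <*> M)%G); last exact: joing_subr.
by rewrite /= properEneq neUMG join_subG sUG.
Qed.

(** Modulo the core [C] of [M], a minimal normal subgroup [U / C] is a [q]-group not inside [M / C];
    thus [U * M = G], and the index of [M] divides that of [C] in [U]. *)
Lemma maximal_index_pnat (gT : finGroupType) (G M : {group gT}) :
  solvable G -> maximal M G -> exists2 q, prime q & q.-nat #|G : M|.
Proof.
move=> solG maxM; have sMG := proper_sub (maxgroupp maxM).
pose C := [group of gcore M G]; have nsCG : C <| G by apply: gcore_normal.
have sCM : C \subset M := gcore_sub _ _.
have ntGC : G / C != 1.
  apply: contraTneq (maxgroupp maxM) => /trivgP; rewrite quotient_sub1 ?normal_norm //.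
  by move=> sGC; rewrite /proper (subset_trans sGC) ?andbF.
have [V minV sVG] := minnormal_exists ntGC (normG _).
have [nVG ntV /is_abelemP[q q_pr abV]] :=
  minnormal_solvable minV sVG (quotient_sol _ solG).
have nsV : V <| G / C by apply/andP.
have [U defU sCU nsUG] := inv_quotientN nsCG nsV.
exists q => //.
have nsUM : ~~ (U \subset M).
  apply: contra ntV => sUM; rewrite -subG1 defU quotient_sub1.
    by rewrite sub_gcore // normal_norm.
  exact: subset_trans (normal_sub nsUG) (normal_norm nsCG).
rewrite -(maximal_mulg maxM nsUG nsUM).
have nUM := subset_trans sMG (normal_norm nsUG).
rewrite -normC // indexMg; apply: (@pnat_dvd _ #|U : C|).
  by rewrite -(indexgI U M) indexgS // subsetI sCU.
rewrite -card_quotient ?(subset_trans (normal_sub nsUG)) ?normal_norm // -defU.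
exact: abelem_pgroup abV.
Qed.

Lemma size_primes_maximal (gT : finGroupType) (G M : {group gT}) :
  solvable G -> maximal M G -> size (primes #|G|) <= (size (primes #|M|)).+1.
Proof.
move=> solG maxM; have [q q_pr qGM] := maximal_index_pnat solG maxM.
have sMG := proper_sub (maxgroupp maxM).
apply: (@uniq_leq_size _ _ (q :: primes #|M|)); first exact: primes_uniq.
move=> p; rewrite -(Lagrange sMG) primesM ?cardG_gt0 // inE.
case/orP=> [-> | p_dv]; first exact: orbT.
by case/andP: qGM => _ /allP/(_ p p_dv)/eqP->; rewrite eqxx.
Qed.

Lemma n_maximal_sub (gT : finGroupType) (G H : {group gT}) n :
  n_maximal G n H -> H \subset G.
Proof.
elim=> [{}H maxH | m K {}H _ sKG maxH]; first exact: proper_sub (maxgroupp maxH).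
exact: subset_trans (proper_sub (maxgroupp maxH)) sKG.
Qed.

(** Extends the chain at its top, whereas [SuccMaximal] extends it at the bottom. *)
Lemma n_maximalS (gT : finGroupType) (G M H : {group gT}) n :
  maximal M G -> n_maximal M n H -> n_maximal G n.+1 H.
Proof.
move=> maxM; elim=> [{}H | m K {}H _]; last exact: SuccMaximal.
exact/SuccMaximal/OneMaximal.
Qed.

(** [N <| K] is kept in the conclusion because the next maximal subgroup is pulled back through
    [K / N]. *)
Lemma n_maximal_quotient (gT : finGroupType) (G N : {group gT}) n
    (H : {group coset_of N}) :
    N <| G -> n_maximal (G / N)%G n H ->
  exists K : {group gT}, [/\ n_maximal G n K, N <| K & H = (K / N)%G].
Proof.
move=> nsNG; elim=> [{}H maxH | m L {}H _ [K [nmaxK nsNK defL]] maxH].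
  have nsNH : N <| coset N @*^-1 H := normal_cosetpre H.
  exists (coset N @*^-1 H)%G; split=> //; last by apply: group_inj; rewrite /= cosetpreK.
  by apply: OneMaximal; rewrite -(quotientGK nsNG) cosetpre_maximal.
have maxHK : maximal H (K / N) by rewrite -[K / N]/(gval (K / N)%G) -defL.
have nsNH : N <| coset N @*^-1 H := normal_cosetpre H.
exists (coset N @*^-1 H)%G; split=> //; last by apply: group_inj; rewrite /= cosetpreK.
by apply: SuccMaximal nmaxK _; rewrite -(quotientGK nsNK) cosetpre_maximal.
Qed.

(** Descend through maximal subgroups containing [R]. Each loses at most one prime, so before every
    descent at least two primes remain and the group is not yet [R]. *)
Lemma n_maximal_Sylow_exists (gT : finGroupType) (G R : {group gT}) (r n : nat) :
    solvable G -> 0 < n -> r.-group R -> R \subset G -> n < size (primes #|G|) ->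
  exists2 K : {group gT}, n_maximal G n K & R \subset K.
Proof.
move=> solG n_gt0 rR; elim: n n_gt0 G solG => // n IHn _ G solG sRG lt_n_piG.
have [defR | [M maxM sRM]] := maximal_exists sRG.
  move: lt_n_piG; rewrite -defR; case: (eqsVneq R 1) => [->|ntR].
    by rewrite cards1.
  by have [r_pr _ [e ->]] := pgroup_pdiv rR ntR; rewrite primesX // primes_prime.
have le_piM := size_primes_maximal solG maxM.
case: n IHn lt_n_piG => [_ _ | n IHn lt_n_piG].
  by exists M => //; apply: OneMaximal.
have solM := solvableS (proper_sub (maxgroupp maxM)) solG.
have [||||K nmaxK sRK] := IHn _ M; rewrite //.
  by rewrite -ltnS (leq_trans lt_n_piG).
by exists K => //; apply: n_maximalS nmaxK.
Qed.

(** * Existence of a normal Sylow subgroup *)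

Definition n_maximal_ore (gT : finGroupType) (G : {group gT}) n :=
  forall H : {group gT}, n_maximal G n H -> ore_subnormal G H.

Lemma n_maximal_ore_maximal (gT : finGroupType) (G M : {group gT}) n :
  n_maximal_ore G n.+1 -> maximal M G -> n_maximal_ore M n.
Proof.
move=> oreG maxM H nmaxH; have sMG := proper_sub (maxgroupp maxM).
apply: ore_subnormal_in (n_maximal_sub nmaxH) sMG _.
exact/oreG/(n_maximalS maxM).
Qed.

Lemma n_maximal_ore_quotient (gT : finGroupType) (G N : {group gT}) n :
  N <| G -> n_maximal_ore G n -> n_maximal_ore (G / N)%G n.
Proof.
move=> nsNG oreG H /(n_maximal_quotient nsNG)[K [nmaxK _ ->]].
exact/ore_subnormal_quotient/oreG.
Qed.

(** Otherwise some maximal [M] contains [G :&: 'N(R)] and, being [ore_subnormal], every conjugate of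
    [R]. Sylow's theorem in [M] writes each [x] of [G] as an element of ['N(R)] times one of [M], so
    [M = G]. *)
Lemma Sylow_max_normal1 (gT : finGroupType) (G R : {group gT}) (r : nat) :
    n_maximal_ore G 1 -> {in \pi(G), forall p, p <= r} -> r.-Sylow(G) R ->
  R <| G.
Proof.
move=> oreG r_max sylR; have [sRG rR _] := and3P sylR.
have [defN | [M maxM sNM]] := maximal_exists (subsetIl G 'N(R)).
  by rewrite /normal sRG; apply/setIidPl.
have oreM := oreG M (OneMaximal maxM); have sMG := ore_subnormal_sub oreM.
have sRM : R \subset M by apply: subset_trans sNM; rewrite subsetI sRG normG.
case/andP: (maxgroupp maxM) => _ /negP[].
apply/subsetP=> x Gx; have sylRx : r.-Sylow(M) (R :^ x).
  apply: pHall_subl (sMG) _; last by rewrite pHallJ.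
  apply: ore_subnormal_Sylow oreM sylR sRM r_max _ _; first by rewrite conj_subG.
  by rewrite pgroupJ.
have [y My defRx] := Sylow_trans (pHall_subl sRM sMG sylR) sylRx.
rewrite -[x](mulgKV y) groupM // (subsetP sNM) // inE.
rewrite groupM ?groupV ?(subsetP sMG y) //=.
by rewrite inE conjsgM defRx conjsgK.
Qed.

Lemma Sylow_max_normal (gT : finGroupType) (G R : {group gT}) (r n : nat) :
    solvable G -> 0 < n -> n_maximal_ore G n -> n < size (primes #|G|) ->
    {in \pi(G), forall p, p <= r} -> r.-Sylow(G) R ->
  R <| G.
Proof.
case: n => // n solG _; elim: n G solG => [|n IHn] G solG oreG lt_n_piG r_max sylR.
  exact: Sylow_max_normal1 sylR.
have [sRG rR _] := and3P sylR.
have [defR | [M maxM sRM]] := maximal_exists sRG; first by rewrite defR normal_refl.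
have sMG := proper_sub (maxgroupp maxM); have solM := solvableS sMG solG.
have lt_n_piM : n.+1 < size (primes #|M|).
  by rewrite -ltnS (leq_trans lt_n_piG) ?size_primes_maximal.
have sylRM := pHall_subl sRM sMG sylR.
have nsRM : R <| M.
  apply: IHn sylRM => //; first exact: n_maximal_ore_maximal maxM.
  by move=> p /(pi_of_dvd (cardSg sMG) (cardG_gt0 _)); apply: r_max.
(* [K] is taken inside [M], where [R] is already known to be normal. *)
have [K nmaxK sRK] := n_maximal_Sylow_exists solM (ltn0Sn n) rR sRM lt_n_piM.
have oreK := oreG K (n_maximalS maxM nmaxK).
exact: Sylow_normal_ore oreK (n_maximal_sub nmaxK) sylR sRK r_max nsRM sMG.
Qed.

(** [N :&: M] is normalised by [M] and centralised by the abelian [N], so it is normal in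
    [N * M = G] and minimality applies. *)
Lemma minnormal_capI1 (gT : finGroupType) (G M N : {group gT}) :
    minnormal N G -> N \subset G -> abelian N -> (N * M)%g = G ->
    ~~ (N \subset M) -> N :&: M = 1.
Proof.
case/mingroupP=> /andP[_ nNG] minN sNG abN defG; apply: contraNeq => ntNM.
rewrite -(minN (N :&: M)%G) ?subsetIl ?subsetIr //= ntNM -defG mul_subG //.
  by rewrite cents_norm // (subset_trans _ (centS (subsetIl _ _))).
by rewrite normsI ?normG // (subset_trans _ nNG) // -defG mulG_subr.
Qed.

Lemma normal_Sylow_exists (gT : finGroupType) (G : {group gT}) (n : nat) :
    solvable G -> 0 < n -> n_maximal_ore G n -> n <= size (primes #|G|) ->
  exists p, p \in \pi(G) /\ exists2 P : {group gT}, p.-Sylow(G) P & P <| G.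
Proof.
have [m] := ubnP #|G|.
elim: m gT G n => // m IHm gT G n ltGm solG n_gt0 oreG le_n_piG.
have ntG : G :!=: 1.
  by apply: contraTneq le_n_piG => ->; rewrite cards1 -ltnNge.
have r_max : {in \pi(G), forall p, p <= max_pdiv #|G|}.
  by move=> p; apply: max_pdiv_max.
have pi_r : max_pdiv #|G| \in \pi(G) by rewrite pi_max_pdiv cardG_gt1.
move: (max_pdiv _) r_max pi_r => r r_max pi_r.
case: n n_gt0 => [//|[_|n _]] in oreG le_n_piG *.
  have [R sylR] := Sylow_exists r G.
  by exists r; split=> //; exists R => //; apply: Sylow_max_normal1 oreG r_max sylR.
have [N minN sNG] := minnormal_exists ntG (normG _).
have [nNG ntN /is_abelemP[q q_pr abN]] := minnormal_solvable minN sNG solG.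
have nsNG : N <| G by apply/andP.
have qN := abelem_pgroup abN.
(* If [q] does not divide the order of [G / N], then [N] itself is a Sylow subgroup; otherwise
   [G / N] keeps all primes of [G]. *)
have [q_dv | q'GN] := boolP (q \in \pi(G / N)); last first.
  exists q; split.
    have [_ q_dvN _] := pgroup_pdiv qN ntN.
    by apply: (piSg sNG); rewrite mem_primes q_pr cardG_gt0.
  exists N => //; rewrite /pHall sNG qN -card_quotient //.
  by rewrite -[_.-nat _]/(_.-group _) p'groupEpi.
have sub_pi : {subset \pi(G) <= \pi(G / N)}.
  move=> p; change (p \in primes #|G| -> p \in primes #|G / N|).
  rewrite -(Lagrange sNG) primesM ?cardG_gt0 // -card_quotient //.
  by case/orP=> // p_dv; case/andP: qN => _ /allP/(_ p p_dv)/eqP->.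
have le_n_piGN : n.+2 <= size (primes #|G / N|).
  by rewrite (leq_trans le_n_piG) // uniq_leq_size ?primes_uniq.
have [|||||p [pi_p [Pb sylPb nsPb]]] := IHm _ (G / N)%G n.+2;
  rewrite ?quotient_sol //.
- by rewrite (leq_trans (ltn_quotient _ _)).
- exact: n_maximal_ore_quotient.
have [S defS sNS nsSG] := inv_quotientN nsNG nsPb.
have [P sylP] := Sylow_exists p S.
have nNS := subset_trans (normal_sub nsSG) nNG.
have [sSG [sPS pP p'SP]] := (normal_sub nsSG, and3P sylP).
have [_ pS p'GS] := and3P sylPb.
have sylPG : p.-Sylow(G) P.
  rewrite /pHall (subset_trans sPS) // pP -(Lagrange_index sSG sPS) pnatM p'SP andbT.
  by rewrite -(index_quotient_normal nsNG) // -defS.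
have pi_Gp : p \in \pi(G) := pi_of_dvd (dvdn_quotient _ _) (cardG_gt0 _) pi_p.
have [defN | [M maxM sNPM]] := maximal_exists (subsetIl G 'N(P)).
  exists p; split=> //; exists P => //.
  by rewrite /normal (pHall_sub sylPG); apply/setIidPl.
have [sMG not_sGM] := andP (maxgroupp maxM); have solM := solvableS sMG solG.
(* By the Frattini argument [G] is the product of [S = N * P] and [G :&: 'N(P)], so [M] would be all
   of [G] if it contained [N]. *)
have not_sNM : ~~ (N \subset M).
  apply: contra not_sGM => sNM; rewrite -(Frattini_arg nsSG sylP) mul_subG //.
  have sPM : P \subset M.
    by apply: subset_trans sNPM; rewrite subsetI (pHall_sub sylPG) normG.
  apply: subset_trans (mul_subG sNM sPM); rewrite -quotientSK // -defS.
  rewrite (pHall_id (quotient_pHall (subset_trans sPS nNS) sylP)) /= -defS //.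
have defG := maximal_mulg maxM nsNG not_sNM.
have tiNM := minnormal_capI1 minN sNG (abelem_abelian abN) defG not_sNM.
have nNM := subset_trans sMG nNG.
have defGN : G / N = M / N by rewrite -defG quotientMidl.
have oM : #|M| = #|G / N|.
  by rewrite defGN card_quotient // -indexgI setIC tiNM indexg1.
have [R sylR] := Sylow_exists r M; have [sRM rR r'MR] := and3P sylR.
(* [M] has the order of [G / N], hence at least [n + 2] primes, while the hypothesis descends to [M]
   with [n + 1]. *)
have nsRM : R <| M.
  apply: (@Sylow_max_normal _ _ _ r n.+1) => //; rewrite ?oM //.
    exact: n_maximal_ore_maximal maxM.
  by move=> p1 /(piSg sMG); apply: r_max.
exists r; split=> //; have [def_q | neq_qr] := eqVneq q r.
  have nNR := subset_trans sRM nNM.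
  exists (N <*> R)%G; last first.
    rewrite /normal join_subG sNG (subset_trans sRM) //= -{1}defG mul_subG //.
      exact: subset_trans (joing_subl _ _) (normG _).
    exact: normsY nNM (normal_norm nsRM).
  have nsNR : N <| N <*> R by rewrite normalYl.
  rewrite -(pquotient_pHall _ nsNG) //= ?quotientYidl // -?def_q ?defGN //.
  by rewrite quotient_pHall // def_q.
have sylRG : r.-Sylow(G) R.
  rewrite /pHall (subset_trans sRM) // rR -(Lagrange_index sMG sRM) pnatM r'MR andbT.
  rewrite -defG -normC // indexMg; apply: pnat_dvd (dvdn_indexg _ _) _.
  by apply: pi_pnat qN _; rewrite !inE.
exists R => //.
have [||K nmaxK sRK] := @n_maximal_Sylow_exists _ M R r n.+1 solM _ rR sRM;
  rewrite ?oM //.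
have oreK := oreG K (n_maximalS maxM nmaxK).
exact: Sylow_normal_ore oreK (n_maximal_sub nmaxK) sylRG sRK r_max nsRM sMG.
Qed.

(** * Orderings of the primes and dispersive groups *)

Definition lower_pred (phi : rel nat) (p : nat) : nat_pred := [pred q | phi q p].

(** Asking for all initial segments of [phi] avoids adjusting a list of primes when passing to a
    quotient. The segment at [p] contains [p], since a prime ordering is reflexive on primes. *)
Definition tower (phi : rel nat) (gT : finGroupType) (G : {group gT}) :=
  forall p, prime p ->
    exists2 N : {group gT}, N <| G & (lower_pred phi p).-Hall(G) N.

Definition first_rel (p : nat) (phi : rel nat) : rel nat :=
  fun a b => (a == p) || (b != p) && phi a b.

Lemma prime_ordering_first (p : nat) (phi : rel nat) :
  prime_ordering phi -> prime_ordering (first_rel p phi).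
Proof.
case=> phi_total phi_anti phi_tr.
split=> [a b pr_a pr_b|a b pr_a pr_b|b a c pr_b pr_a pr_c]; rewrite /first_rel.
- by case: (eqVneq a p) => //= _; case: (eqVneq b p) => //= _; apply: phi_total.
- by case: (eqVneq a p) => [->|_]; case: (eqVneq b p) => [->|_] //=; apply: phi_anti.
- case: (eqVneq a p) => //= _; case: (eqVneq b p) => //= _ /=.
  by case: (eqVneq c p) => //= _; apply: phi_tr.
Qed.

Lemma tower_quotient (phi : rel nat) (gT : finGroupType) (G P : {group gT}) :
  G \subset 'N(P) -> tower phi G -> tower phi (G / P)%G.
Proof.
move=> nPG towG p /towG[N nsNG hallN]; exists (N / P)%G; first exact: quotient_normal.
by rewrite quotient_pHall // (subset_trans (normal_sub nsNG)).
Qed.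

(** The new segment at [p] is [p] alone, with Hall subgroup [P]. At another [b], [p] joins the old
    segment, and the preimage of the Hall subgroup of [G / P] serves. *)
Lemma tower_first (phi : rel nat) (gT : finGroupType) (G P : {group gT}) (p : nat) :
    P <| G -> p.-Sylow(G) P -> tower phi (G / P)%G -> tower (first_rel p phi) G.
Proof.
move=> nsPG sylP towGP b b_pr; have [sPG pP p'GP] := and3P sylP.
have [-> | neq_bp] := eqVneq b p.
  by exists P; rewrite // (@eq_pHall _ _ p) // => a; rewrite !inE /first_rel eqxx orbF.
have [N' nsN' /and3P[_ piN' pi'N']] := towGP b b_pr.
have [N defN sPN nsNG] := inv_quotientN nsPG nsN'.
exists N => //; have sNG := normal_sub nsNG.
have nPN := subset_trans sNG (normal_norm nsPG).
rewrite /pHall sNG /= /pgroup -(Lagrange sPN) pnatM -(card_quotient nPN) -defN.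
apply/andP; split.
  apply/andP; split; [apply: sub_in_pnat pP | apply: sub_in_pnat piN'] => a _.
    by rewrite !inE /first_rel => ->.
  by rewrite !inE /first_rel neq_bp => ->; rewrite orbT.
rewrite defN (index_quotient_normal nsPG) // in pi'N'.
have p'GN : p^'.-nat #|G : N|.
  by apply: pnat_dvd p'GP; rewrite -(Lagrange_index sNG sPN) dvdn_mulr.
apply/pnatP=> // a a_pr a_dv.
have pi_a : a \in \pi(#|G : N|) by rewrite mem_primes a_pr indexg_gt0.
have := pnatPpi p'GN pi_a; have := pnatPpi pi'N' pi_a.
by rewrite !inE /first_rel neq_bp negb_or => -> ->.
Qed.

Lemma partn_prod_seq (pi : nat_pred) (n : nat) (s : seq nat) :
    0 < n -> uniq s -> (forall q, (q \in s) = (q \in primes n) && (q \in pi)) ->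
  (n`_pi = \prod_(q <- s) q ^ logn q n)%N.
Proof.
move=> n_gt0 uniq_s mem_s; rewrite /partn (bigID (mem (primes n))) /=.
rewrite [X in (_ * X)%N]big1 ?muln1 => [|q /andP[_ q'n]]; last first.
  by rewrite lognE -mem_primes (negPf q'n).
rewrite -big_filter; apply/perm_big/uniq_perm; rewrite ?filter_uniq ?iota_uniq // => q.
rewrite mem_filter mem_s mem_index_iota ltnS andbC andbA.
case q_n: (q \in primes n); rewrite ?andbF //= andbT.
by move: q_n; rewrite mem_primes => /and3P[_ _ /dvdn_leq->].
Qed.

(** With the primes of the order sorted by [phi], the first [i] are exactly those in the segment at
    the last of them, which provides [N]. *)
Lemma tower_dispersive (phi : rel nat) (gT : finGroupType) (G : {group gT}) :
  prime_ordering phi -> tower phi G -> dispersive phi G.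
Proof.
case=> phi_total phi_anti phi_tr towG; pose qs := sort phi (primes #|G|).
have pr_primes : all [in prime] (primes #|G|).
  by apply/allP=> q; rewrite mem_primes => /andP[].
have pr_qs : all [in prime] qs by rewrite all_sort.
have uniq_qs : uniq qs by rewrite sort_uniq primes_uniq.
have pair_qs : pairwise [rel p q | phi p q && (p != q)] qs.
  rewrite pairwise_relI -uniq_pairwise uniq_qs andbT.
  by rewrite -(sorted_pairwise_in phi_tr) // (sort_sorted_in phi_total).
exists qs; split; [by rewrite perm_sort | exact: pairwise_sorted |].
move=> i /andP[i_gt0 le_i]; have size_t : size (take i qs) = i by rewrite size_takel.
case/lastP def_t: (take i qs) => [|t p].
  by rewrite -size_t def_t in i_gt0.
have def_qs : qs = rcons t p ++ drop i qs by rewrite -def_t cat_take_drop.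
have p_qs : p \in qs by rewrite def_qs mem_cat mem_rcons mem_head.
have p_pr := allP pr_qs p p_qs.
have [N nsNG hallN] := towG p p_pr; exists N => //.
rewrite (card_Hall hallN); apply: partn_prod_seq; rewrite ?cardG_gt0 //.
  by rewrite -def_t take_uniq.
move: pair_qs; rewrite {1}def_qs pairwise_cat pairwise_rcons.
case/and3P=> /allrelP le_td /andP[/allP le_tp _] _ q.
have -> : (q \in primes #|G|) = (q \in qs) by rewrite mem_sort.
rewrite def_qs mem_cat andb_orl inE -(orbF (q \in rcons t p)); congr (_ || _).
  case q_t: (q \in rcons t p) => //=; symmetry.
  move: q_t; rewrite mem_rcons inE => /predU1P[-> | /le_tp/andP[]//].
  by have := phi_total p p p_pr p_pr; rewrite orbb.
symmetry; apply/negP=> /andP[q_d le_qp].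
have p_t : p \in rcons t p by rewrite mem_rcons mem_head.
have /= /andP[le_pq /negP[]] := le_td p q p_t q_d.
apply/eqP/phi_anti; rewrite ?le_pq //.
by apply: (allP pr_qs); rewrite def_qs mem_cat q_d orbT.
Qed.

Lemma prime_ordering_leq : prime_ordering leq.
Proof.
split=> [a b _ _ | a b _ _ | b a c _ _ _].
- exact: leq_total.
- exact: anti_leq.
- exact: leq_trans.
Qed.

Lemma tower_exists (gT : finGroupType) (G : {group gT}) (n : nat) :
    solvable G -> 0 < n -> n_maximal_ore G n -> n <= size (primes #|G|) ->
  exists2 phi, prime_ordering phi & tower phi G.
Proof.
have [m] := ubnP #|G|.
elim: m gT G n => // m IHm gT G n ltGm solG n_gt0 oreG le_n_piG.
have [p [pi_p [P sylP nsPG]]] := normal_Sylow_exists solG n_gt0 oreG le_n_piG.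
have ntP : P :!=: 1 by rewrite -rank_gt0 (rank_Sylow sylP) p_rank_gt0.
suffices [phi ord_phi tow_phi]: exists2 phi, prime_ordering phi & tower phi (G / P)%G.
  by exists (first_rel p phi); [apply: prime_ordering_first | apply: tower_first tow_phi].
have [sPG nPG] := andP nsPG.
case: n n_gt0 => [//|[_|n _]] in oreG le_n_piG *.
  (* The induction hypothesis needs a prime dividing the order of [G / P]; for trivial [G / P] any
     ordering works. *)
  have [GP1 | ntGP] := eqVneq (G / P) 1.
    exists leq; first exact: prime_ordering_leq.
    move=> q _; exists (G / P)%G; first exact: normal_refl.
    by rewrite /pHall subxx indexgg /pgroup /= GP1 cards1.
  apply: (IHm _ _ 1%N); rewrite ?quotient_sol //.
  - by rewrite (leq_trans (ltn_quotient _ _)).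
  - exact: n_maximal_ore_quotient.
  - have: max_pdiv #|G / P| \in primes #|G / P| by rewrite pi_max_pdiv cardG_gt1.
    by case: (primes _).
(* [G / P] has lost the prime [p] and may have only [n + 1] primes, too few for the hypothesis at
   [n + 2]. A maximal [M] above a complement of [P] maps onto [G / P] and satisfies the hypotheses
   at [n + 1]. *)
have [H /complP[tiPH defG]] := splitsP (SchurZassenhaus_split (pHall_Hall sylP) nsPG).
have sHG : H \subset G by rewrite -defG mulG_subr.
have [defH | [M maxM sHM]] := maximal_exists sHG.
  by case/eqP: ntP; rewrite -tiPH defH (setIidPl sPG).
have ltMG := maxgroupp maxM; have sMG := proper_sub ltMG.
have [|||||phi ord_phi tow_phi] := IHm _ M n.+1; rewrite ?(solvableS sMG) //.
- by rewrite (leq_trans (proper_card ltMG)).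
- exact: n_maximal_ore_maximal maxM.
- by rewrite -ltnS (leq_trans le_n_piG) ?size_primes_maximal.
exists phi => //; rewrite (_ : (G / P)%G = (M / P)%G).
  exact: tower_quotient (subset_trans sMG nPG) tow_phi.
apply/group_inj/eqP; rewrite /= eqEsubset (quotientS _ sMG) andbT.
by rewrite -defG quotientMidl quotientS.
Qed.

Local Close Scope group_scope.

Theorem theoremD (F : group_class)
    (F_formation : formation F) (F_saturated : saturated F)
    (nil_sub_F : forall (gT : finGroupType) (G : {group gT}),
       nilpotent G -> in_class F G)
    (F_sub_super : forall (gT : finGroupType) (G : {group gT}),
       in_class F G -> supersolvable G)
    (n : nat) (n_ge1 : 1 <= n)
    (gT : finGroupType) (G : {group gT}) (solG : solvable G)
    (max_sub : forall H : {group gT}, n_maximal G n H -> F_subnormal F G H)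
    (pi_ge : n <= size (primes #|G|)) :
  exists2 phi : rel nat, prime_ordering phi & dispersive phi G.
Proof.
have oreG : n_maximal_ore G n.
  by move=> H /max_sub; apply: F_subnormal_ore.
have [phi ord_phi tow_phi] := tower_exists solG n_ge1 oreG pi_ge.
by exists phi => //; apply: tower_dispersive.
Qed.
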